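(* Let $\mathcal{A}$ be a nilpotent associative algebra over a field that has no nonzero nilpotent element possessing a square root in $\mathcal{A}$ (that is, $a^2=\mathbf{0}$ for every $a\in\mathcal{A}$). Then $\mathcal{A}$ is an almost inner Rickart algebra.
   Context: Let $\mathcal{A}$ be an associative algebra (not necessarily with unit) which decomposes, as a linear space, into a direct sum $\mathcal{A}=\mathcal{S}\dot{+}\mathcal{N}$ of a semisimple subalgebra $\mathcal{S}$ and the nilpotent radical $\mathcal{N}$ of $\mathcal{A}$ (each may be $\{\mathbf{0}\}$; if $\mathcal{A}$ is nilpotent then $\mathcal{S}=\{\mathbf{0}\}$ and $\mathcal{N}=\mathcal{A}$). Put $\mathcal{S}^2:=\{a^2: a\in\mathcal{S}\}$ and $\mathcal{N}^2:=\{a^2: a\in\mathcal{N}\}$ (sets of squares, not spans). For nonempty $\mathcal{B}\subseteq\mathcal{A}$ the (inner) quadratic annihilator is ${}^{\perp_q}\mathcal{B}:=\{a\in\mathcal{A}: sas=\mathbf{0}\ \forall s\in\mathcal{B}\}$. The algebra $\mathcal{A}$ is called an almost inner Rickart algebra if for every $x\in\mathcal{A}$ there exists an idempotent $e\in\mathcal{A}$ (possibly $e=\mathbf{0}$) such that ${}^{\perp_q}\{x\}\cap(\mathcal{S}^2\cup\mathcal{N}^2)=e\mathcal{A}e\cap(\mathcal{S}^2\cup\mathcal{N}^2)$. *)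

(* Defs.v *)
From HB Require Import structures.
From mathcomp Require Import all_boot all_order all_algebra.
From mathcomp Require Import boolp classical_sets.

Set Implicit Arguments.
Unset Strict Implicit.
Unset Printing Implicit Defensive.

Import GRing.Theory.

Local Open Scope classical_set_scope.
Local Open Scope ring_scope.

(* Associative algebras over F, of arbitrary dimension and not necessarily
   unital; the product is the semigroup product (x * y)%g, because the ring
   structures of MathComp all have a unit. *)
HB.mixin Record Lmodule_Semigroup_isAssocAlgebra (F : fieldType) A
    of GRing.Lmodule F A & Semigroup A := {
  amulDl : forall x y z : A, ((x + y) * z)%g = (x * z)%g + (y * z)%g;
  amulDr : forall x y z : A, (x * (y + z))%g = (x * y)%g + (x * z)%g;
  ascalerAl : forall (k : F) (x y : A), k *: (x * y)%g = ((k *: x) * y)%g;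
  ascalerAr : forall (k : F) (x y : A), k *: (x * y)%g = (x * (k *: y))%g
}.

#[short(type="assocAlgType")]
HB.structure Definition AssocAlgebra (F : fieldType) :=
  {A of Lmodule_Semigroup_isAssocAlgebra F A & GRing.Lmodule F A & Semigroup A}.

Section AssocAlgebraTheory.
Variables (F : fieldType) (A : assocAlgType F).
Implicit Types (B I N S : set A) (x : A).

Definition subspace B : Prop :=
  B 0 /\ forall (k : F) (x y : A), B x -> B y -> B (k *: x + y).

Definition subalgebra B : Prop :=
  subspace B /\ forall x y, B x -> B y -> B (x * y)%g.

(* I is a two-sided ideal of the subalgebra B. *)
Definition ideal_of B I : Prop :=
  [/\ I `<=` B, subspace I &
      forall b x, B b -> I x -> I (b * x)%g /\ I (x * b)%g].

(* B^(n+1) = 0 for some n: x * s_1 * ... * s_n = 0 for x, s_1, ..., s_n in B. *)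
Definition nilpotent_subset B : Prop :=
  exists n : nat, forall x (s : seq A), size s = n ->
    B x -> (forall y, y \in s -> B y) -> foldl (fun a b => (a * b)%g) x s = 0.

(* x^(n+1) = 0 for some n. *)
Definition nilpotent_element x : Prop :=
  exists n : nat, iter n (fun a => (a * x)%g) x = 0.

(* N is the largest nilpotent two-sided ideal of the subalgebra B. *)
Definition nilradical_of B N : Prop :=
  [/\ ideal_of B N, nilpotent_subset N &
      forall I, ideal_of B I -> nilpotent_subset I -> I `<=` N].

(* The zero algebra is semisimple. *)
Definition semisimple B : Prop := nilradical_of B [set 0].

(* A = S (+) N as linear spaces, S a semisimple subalgebra, N the radical. *)
Definition radical_decomposition S N : Prop :=
  [/\ subalgebra S, semisimple S, nilradical_of [set: A] N,
      forall x, exists s n, [/\ S s, N n & x = s + n] &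
      S `&` N = [set 0]].

Definition squares B : set A := [set (a * a)%g | a in B].

Definition inner_quadratic_annihilator B : set A :=
  [set a | forall s, B s -> (s * a * s)%g = 0].

Definition corner (e : A) : set A := [set (e * a * e)%g | a in [set: A]].

Definition almost_inner_rickart_for S N : Prop :=
  forall x, exists e : A, (e * e)%g = e /\
    inner_quadratic_annihilator [set x] `&` (squares S `|` squares N)
    = corner e `&` (squares S `|` squares N).

(* The property is stated for every decomposition A = S (+) N, since S need not
   be unique in general; the first conjunct excludes vacuity. *)
Definition almost_inner_rickart : Prop :=
  (exists S N, radical_decomposition S N) /\
  forall S N, radical_decomposition S N -> almost_inner_rickart_for S N.

End AssocAlgebraTheory.

Arguments almost_inner_rickart {F} A.

(* Main.v *)
Require Import Defs.
From HB Require Import structures.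
From mathcomp Require Import all_boot all_order all_algebra.
From mathcomp Require Import boolp classical_sets.

(** In a nilpotent algebra every element is nilpotent, in particular every
    square, so the hypothesis on square roots says that all squares vanish
    ([square_eq0]). Hence the set of squares in which the Rickart condition is
    tested is just [{0}], whatever the decomposition [A = S + N], and that
    condition compares two subsets of [{0}] which both contain [0]: the
    idempotent [e = 0] works for every [x]
    ([almost_inner_rickart_for_square0]). A decomposition exists because a
    nilpotent algebra is its own radical, with semisimple part [0]
    ([radical_decomposition_nilpotent]). *)

Import GRing.Theory.

Local Open Scope classical_set_scope.
Local Open Scope ring_scope.

Lemma amul0x (F : fieldType) (A : assocAlgType F) (x : A) : (0 * x)%g = 0 :> A.
Proof. by rewrite -[X in (X * _)%g](scale0r (0 : A)) -ascalerAl scale0r. Qed.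

Lemma amulx0 (F : fieldType) (A : assocAlgType F) (x : A) : (x * 0)%g = 0 :> A.
Proof. by rewrite -[X in (_ * X)%g](scale0r (0 : A)) -ascalerAr scale0r. Qed.

Lemma nilpotent_subset_element (F : fieldType) (A : assocAlgType F)
    (B : set A) (x : A) :
  nilpotent_subset B -> B x -> nilpotent_element x.
Proof.
move=> [n nilB] Bx; exists n.
have <- : foldl (fun a b => (a * b)%g) x (nseq n x) = 0.
  apply: nilB; [exact: size_nseq | exact: Bx | ].
  by move=> y /nseqP[-> _].
(* the accumulator varies while the factor x stays fixed *)
move: {2 3}x => y; elim: n {nilB} y => //= n IHn y.
by rewrite -IHn -iterSr.
Qed.

(** A square lies in the nilpotent algebra, hence is a nilpotent element, and it
    has a square root by construction. *)
Lemma square_eq0 (F : fieldType) (A : assocAlgType F)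
    (nilA : nilpotent_subset [set: A])
    (no_sqrt : forall x : A,
       nilpotent_element x -> (exists a : A, (a * a)%g = x) -> x = 0) (a : A) :
  (a * a)%g = 0.
Proof.
apply: no_sqrt; last by exists a.
exact: nilpotent_subset_element nilA I.
Qed.

Lemma subspace0 (F : fieldType) (A : assocAlgType F) : subspace [set (0 : A)].
Proof. by split=> // k x y -> ->; rewrite /= scaler0 addr0. Qed.

(** Ideals of the zero algebra are contained in [{0}], so maximality of the
    radical holds by inclusion alone. *)
Lemma semisimple0 (F : fieldType) (A : assocAlgType F) :
  semisimple [set (0 : A)].
Proof.
split; last by move=> I [].
- split=> //; first exact: subspace0.
  by move=> b x -> ->; rewrite /= amul0x.
- (* the witness 0 encodes nilpotency exponent 1, products of a single factor *)
  by exists 0%N => x s /size0nil ->.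
Qed.

Lemma radical_decomposition_nilpotent (F : fieldType) (A : assocAlgType F) :
  nilpotent_subset [set: A] -> radical_decomposition [set (0 : A)] [set: A].
Proof.
move=> nilA; split.
- split; first exact: subspace0.
  by move=> x y -> ->; rewrite /= amul0x.
- exact: semisimple0.
- by split.
- by move=> x; exists 0, x; rewrite add0r.
- by rewrite setIT.
Qed.

(** The only element to be tested is [0], and it lies both in every quadratic
    annihilator and in every corner. Having [0] in [N] makes the set of squares
    nonempty, hence equal to [{0}]. *)
Lemma almost_inner_rickart_for_square0 (F : fieldType) (A : assocAlgType F)
    (S N : set A) :
  (forall a : A, (a * a)%g = 0) -> N 0 -> almost_inner_rickart_for S N.
Proof.
move=> sq0 N0 x; exists 0; split; first exact: sq0.
have -> : squares S `|` squares N = [set 0].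
  apply/seteqP; split=> [y [] [a _ <-] | y ->]; rewrite /= ?sq0 //.
  by right; exists 0; rewrite ?sq0.
rewrite !setIidr // => y ->.
- by exists 0; rewrite ?amul0x.
- by move=> s _; rewrite amulx0 amul0x.
Qed.

Theorem theorem2p2 (F : fieldType) (A : assocAlgType F)
  (nilA : nilpotent_subset [set: A])
  (no_sqrt : forall x : A,
     nilpotent_element x -> (exists a : A, (a * a)%g = x) -> x = 0) :
  almost_inner_rickart A.
Proof.
split; first by exists [set 0], [set: A]; exact: radical_decomposition_nilpotent.
move=> S N [_ _ [[_ [N0 _] _] _ _] _ _].
apply: almost_inner_rickart_for_square0 N0.
exact: square_eq0.
Qed.
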